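(* Let $(B,W)$ be a permutation group on a finite set, $B\neq I_1$, with $B\in GR\cup\{I_2\}$. Then $B\times I_2\in GR$.
   Context: A permutation group $(B,W)$ is a group $B$ of permutations of a set $W$; $I_n$ denotes the trivial group (identity only) acting on an $n$-element set; groups are considered up to permutation isomorphism. The direct product of $(B,W)$ and $(C,U)$ acts on $W\times U$ by $(b,c)(x,y)=(b(x),c(y))$. An edge-colored graph on a set $X$ is a function $E$ from the 2-element subsets of $X$ to a finite set of colors, with automorphisms the permutations $\sigma$ of $X$ satisfying $E(\{\sigma(x),\sigma(x')\})=E(\{x,x'\})$ for all distinct $x,x'$. $GR$ is the class of permutation groups that equal the full automorphism group of some edge-colored graph on their underlying set. *)

(* Defs.v *)
From mathcomp Require Import all_boot all_fingroup.

Set Implicit Arguments.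
Unset Strict Implicit.
Unset Printing Implicit Defensive.

(* A permutation group (B, W) on a finite set is B : {group {perm W}}. *)

Section EdgeColoredGraphs.

Variable X : finType.

Definition edge := {e : {set X} | #|e| == 2}.

Lemma edge_image_subproof (s : {perm X}) (e : edge) : #|s @: val e| == 2.
Proof. by rewrite card_imset ?(valP e) //; exact: perm_inj. Qed.

(* The edge {x, x'} is sent to {s x, s x'}. *)
Definition edge_image (s : {perm X}) (e : edge) : edge :=
  Sub (s @: val e) (edge_image_subproof s e).

Definition graph_aut (C : finType) (E : edge -> C) : {set {perm X}} :=
  [set s : {perm X} | [forall e : edge, E (edge_image s e) == E e]].

Lemma edge_pair_subproof (x y : X) : x != y -> #|[set x; y]| == 2.
Proof. by move=> xy; rewrite cards2 xy. Qed.

Definition edge_pair (x y : X) (xy : x != y) : edge :=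
  Sub [set x; y] (edge_pair_subproof xy).

Lemma graph_autP (C : finType) (E : edge -> C) (s : {perm X}) :
  reflect
    (forall (x y : X) (xy : x != y) (sxy : s x != s y),
       E (edge_pair sxy) = E (edge_pair xy))
    (s \in graph_aut E).
Proof.
rewrite inE; apply: (iffP forallP) => [h x y xy sxy | h e].
  rewrite -(eqP (h (edge_pair xy))); congr (E _); apply: val_inj => /=.
  by rewrite imsetU1 imset_set1.
have /cards2P[x [y [xy exy]]] := valP e.
have sxy : s x != s y by rewrite (inj_eq perm_inj).
have -> : e = edge_pair xy by exact: val_inj.
rewrite -(h x y xy sxy); apply/eqP; congr (E _); apply: val_inj => /=.
by rewrite imsetU1 imset_set1.
Qed.

Definition GR (B : {group {perm X}}) : Prop :=
  exists (C : finType) (E : edge -> C), B = graph_aut E :> {set {perm X}}.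

End EdgeColoredGraphs.

Section DirectProduct.

Variables W U : finType.

Definition prod_perm_fun (b : {perm W}) (c : {perm U}) (p : W * U) : W * U :=
  (b p.1, c p.2).

Lemma prod_perm_inj b c : injective (prod_perm_fun b c).
Proof. by move=> [x y] [x' y'] [/perm_inj-> /perm_inj->]. Qed.

Definition prod_perm (b : {perm W}) (c : {perm U}) : {perm W * U} :=
  perm (@prod_perm_inj b c).

Definition perm_prod_set (B : {set {perm W}}) (C : {set {perm U}}) :
    {set {perm W * U}} :=
  [set prod_perm b c | b in B, c in C].

Lemma group_set_perm_prod (B : {group {perm W}}) (C : {group {perm U}}) :
  group_set (perm_prod_set B C).
Proof.
apply/group_setP; split=> [|_ _ /imset2P[b c Bb Cc ->] /imset2P[b' c' Bb' Cc' ->]].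
  apply/imset2P; exists 1%g 1%g; rewrite ?group1 //.
  by apply/permP=> -[x y]; rewrite perm1 permE /prod_perm_fun /= !perm1.
apply/imset2P; exists (b * b')%g (c * c')%g; rewrite ?groupM //.
by apply/permP=> -[x y]; rewrite permM !permE /prod_perm_fun /= !permM.
Qed.

Definition perm_prod (B : {group {perm W}}) (C : {group {perm U}}) :
    {group {perm W * U}} :=
  Group (group_set_perm_prod B C).

Definition perm_isomorphic (B : {group {perm W}}) (C : {group {perm U}}) : Prop :=
  exists (f : W -> U) (phi : {morphism B >-> {perm U}}),
    [/\ bijective f, isom B C phi
      & forall (b : {perm W}) (x : W), b \in B -> f (b x) = phi b (f x)].

End DirectProduct.

Definition trivial_perm_group (n : nat) : {group {perm 'I_n}} := 1%G.

(* Main.v *)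
(** For [B] the automorphism group of [E], color an edge [{(x, u), (y, v)}] of
    [W * U] by the pair of [{u, v}] and the [E]-color of [{x, y}], the latter
    being [None] when [x = y].  Edges inside a layer [W * {u}] have first
    component [{u}], so an automorphism preserves every layer when [W] is not a
    singleton; edges colored [None] then force it to act in the same way on
    all layers, and the color inside a layer puts this action in [B].
    The group [I_2 * I_2] is trivial on four points, and a trivial group on at
    least three points is recognized by giving all edges different colors. *)

Require Import Defs.
From mathcomp Require Import all_boot all_fingroup.

Set Implicit Arguments.
Unset Strict Implicit.
Unset Printing Implicit Defensive.

Import GroupScope.

Lemma prod_permE (W U : finType) (b : {perm W}) (c : {perm U}) p :
  prod_perm b c p = (b p.1, c p.2).
Proof. by rewrite permE. Qed.

Lemma perm_prod1P (W U : finType) (B : {group {perm W}}) (s : {perm W * U}) :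
  reflect (exists2 b, b \in B & s = prod_perm b 1)
          (s \in perm_prod_set B (1%G : {group {perm U}})).
Proof.
apply: (iffP imset2P) => [[b c Bb /set1P -> ->]|[b Bb ->]]; first by exists b.
by exists b 1.
Qed.

Lemma perm_prod11 (W U : finType) :
  perm_prod (1%G : {group {perm W}}) (1%G : {group {perm U}}) = 1%G.
Proof.
have prod11 : prod_perm 1 1 = 1 :> {perm W * U}.
  by apply/permP=> -[x u]; rewrite prod_permE !perm1.
apply: val_inj; apply/setP=> s; rewrite inE.
apply/perm_prod1P/eqP => [[b /set1P -> ->] // | ->].
by exists 1; rewrite ?group1 ?prod11.
Qed.

Lemma card_gt2_others (X : finType) (x : X) : 2 < #|X| ->
  exists y z, [/\ x != y, x != z & y != z].
Proof.
rewrite (cardD1 x) inE ltnS => /card_gt1P[y [z [yx zx yz]]]; exists y, z.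
by move: yx zx; rewrite !inE !andbT [y == x]eq_sym [z == x]eq_sym; split.
Qed.

(** With [id] as coloring, an automorphism maps each edge to itself; a third point is needed because
    [x] is then pinned down as the only common point of [{x, y}] and [{x, z}]. *)
Lemma GR_trivial (X : finType) : 2 < #|X| -> GR (1%G : {group {perm X}}).
Proof.
move=> X3; exists (edge X : finType), id; apply/setP=> s; rewrite inE.
apply/eqP/graph_autP => [-> x y xy sxy | s_aut].
  by apply: val_inj; rewrite /= !perm1.
have fixes_edge x y : x != y -> s x \in [set x; y].
  move=> xy; have sxy : s x != s y by rewrite (inj_eq perm_inj).
  by have /(congr1 val)/= <- := s_aut x y xy sxy; rewrite set21.
apply/permP=> x; rewrite perm1.
have [y [z [xy xz yz]]] := card_gt2_others x X3.
case/set2P: (fixes_edge x y xy) => // sxy.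
by case/set2P: (fixes_edge x z xz) => // sxz; rewrite -sxy sxz eqxx in yz.
Qed.

Section LayeredColoring.

Variables (W U : finType) (C : finType) (E : edge W -> C).

(** Projecting the whole edge avoids ordering its endpoints; [insub] gives [None] exactly when the
    first projection collapses to one point. *)
Definition layered_coloring (e : edge (W * U)%type) : {set U} * option C :=
  (snd @: val e, omap E (insub (fst @: val e))).

Lemma layered_coloring_pair p q (pq : p != q) :
  layered_coloring (edge_pair pq) =
  ([set p.2; q.2], omap E (insub [set p.1; q.1])).
Proof. by rewrite /layered_coloring /= !imsetU1 !imset_set1. Qed.

Lemma omap_insub_pair x y (xy : x != y) :
  omap E (insub [set x; y]) = Some (E (edge_pair xy)).
Proof. by rewrite (insubT (fun e : {set W} => #|e| == 2) (edge_pair_subproof xy)). Qed.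

Lemma omap_insub_diag x y : omap E (insub [set x; y]) = None -> x = y.
Proof. by case: (eqVneq x y) => // xy; rewrite (omap_insub_pair xy). Qed.

Lemma omap_insub1 x : omap E (insub [set x; x]) = None.
Proof. by rewrite insubN // setUid cards1. Qed.

Hypothesis other : forall x : W, exists y, x != y.

(** The point [other] supplies an edge inside the layer of [p], and both ends of its image must
    project into the same singleton. *)
Lemma layered_aut_snd s p : s \in graph_aut layered_coloring -> (s p).2 = p.2.
Proof.
move=> /graph_autP s_aut; case: p => x u; have [y xy] := other x.
have pq : (x, u) != (y, u) by rewrite xpair_eqE negb_and xy.
have spq : s (x, u) != s (y, u) by rewrite (inj_eq perm_inj).
have := s_aut _ _ pq spq; rewrite !layered_coloring_pair /= => -[su _].
apply/set1P; have := set21 (s (x, u)).2 (s (y, u)).2.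
by rewrite su setUid.
Qed.

Lemma layered_aut_fst s x u v :
  s \in graph_aut layered_coloring -> (s (x, u)).1 = (s (x, v)).1.
Proof.
move=> /graph_autP s_aut; have [-> // | uv] := eqVneq u v.
have pq : (x, u) != (x, v) by rewrite xpair_eqE eqxx.
have spq : s (x, u) != s (x, v) by rewrite (inj_eq perm_inj).
have := s_aut _ _ pq spq; rewrite !layered_coloring_pair /= omap_insub1.
by case=> _ /omap_insub_diag.
Qed.

Lemma prod_perm_layered_aut b :
  b \in graph_aut E -> prod_perm b 1 \in graph_aut layered_coloring.
Proof.
move=> /graph_autP b_aut; apply/graph_autP=> p q pq spq.
rewrite !layered_coloring_pair !prod_permE /= !perm1; congr (_, _).
have [-> | xy] := eqVneq p.1 q.1; first by rewrite !omap_insub1.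
have bxy : b p.1 != b q.1 by rewrite (inj_eq perm_inj).
by rewrite (omap_insub_pair xy) (omap_insub_pair bxy) b_aut.
Qed.

Lemma layered_aut_prod_perm (u : U) s : s \in graph_aut layered_coloring ->
  exists2 b, b \in graph_aut E & s = prod_perm b 1.
Proof.
move=> s_aut.
(* The action on [W] is read off in layer [u]; since [s] keeps this layer, the first coordinate
   determines the image. *)
have b_inj : injective (fun x => (s (x, u)).1).
  move=> x y sxy; suff /perm_inj[] : s (x, u) = s (y, u) by [].
  by apply: injective_projections; rewrite ?layered_aut_snd.
have sE p : s p = prod_perm (perm b_inj) 1 p.
  rewrite prod_permE permE perm1; case: p => x v /=.
  by apply: injective_projections; rewrite /= ?layered_aut_snd //
    (layered_aut_fst _ v u).
exists (perm b_inj); last exact/permP.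
(* Under [Some], the two [E]-colors are the second components of the layered colors of an edge in
   layer [u] and of its image. *)
apply/graph_autP=> x y xy sxy; apply: Some_inj.
have pq : (x, u) != (y, u) by rewrite xpair_eqE negb_and xy.
have spq : s (x, u) != s (y, u) by rewrite (inj_eq perm_inj).
have /graph_autP/(_ _ _ pq spq) := s_aut.
rewrite !layered_coloring_pair !sE !prod_permE /= (omap_insub_pair xy).
by rewrite (omap_insub_pair sxy) => -[_ ->].
Qed.

End LayeredColoring.

Lemma GR_perm_prod_trivial (W U : finType) (B : {group {perm W}}) (u : U) :
    (forall x : W, exists y, x != y) -> GR B ->
  GR (perm_prod B (1%G : {group {perm U}})).
Proof.
move=> other [C [E BE]].
exists ({set U} * option C)%type, (layered_coloring E); apply/setP=> s.
apply/perm_prod1P/idP => [[b Bb ->] | s_aut].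
  by apply: prod_perm_layered_aut; rewrite -BE.
by rewrite BE; apply: layered_aut_prod_perm.
Qed.

(** This turns the exclusion of [I_1] into a second point for every point of [W]. *)
Lemma perm_isomorphic_I1 (W : finType) (B : {group {perm W}}) (x : W) :
  (forall y, x = y) -> perm_isomorphic B (trivial_perm_group 1).
Proof.
move=> all_x; have perm_id (b : {perm W}) : b = 1.
  by apply/permP=> y; rewrite perm1 -(all_x (b y)).
exists (fun=> ord0), [morphism of trivm B]; split.
- by exists (fun=> x) => y; rewrite ?ord1.
- apply/isomP; split; last by rewrite morphim_trivm.
  by apply/injmP=> a b _ _ _; rewrite (perm_id a) (perm_id b).
- by move=> b y _; rewrite perm1.
Qed.

Lemma perm_isomorphic_trivial (W : finType) (B : {group {perm W}}) n :
  perm_isomorphic B (trivial_perm_group n) -> B = 1%G /\ #|W| = n.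
Proof.
case=> f [phi [/bij_eq_card cardW /isom_isog/isog_eq1 B1 _]].
split; last by rewrite cardW card_ord.
by apply: val_inj; apply/eqP; rewrite B1.
Qed.

Theorem theorem3p9 (W : finType) (B : {group {perm W}})
  (B_neq_I1 : ~ perm_isomorphic B (trivial_perm_group 1))
  (B_GR_or_I2 : GR B \/ perm_isomorphic B (trivial_perm_group 2)) :
  GR (perm_prod B (trivial_perm_group 2)).
Proof.
case: B_GR_or_I2 => [GRB | /perm_isomorphic_trivial[-> W2]].
  apply: (GR_perm_prod_trivial ord0) GRB => x; apply/existsP.
  apply: contraT => /existsPn all_x; case: B_neq_I1.
  by apply: (perm_isomorphic_I1 B (x := x)) => y; apply/eqP/negPn/all_x.
(* [I_2] itself is not in [GR], since the swap preserves the only edge; its product with [I_2] is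
   trivial on [2 * 2] points. *)
by rewrite perm_prod11; apply: GR_trivial; rewrite card_prod W2 card_ord.
Qed.
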